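(* Fix any real number $k\in\left[\tfrac13,1\right)$, and let $\mathcal{S}_k$ be a family of trees such that if $S\in\mathcal{S}_k$ then $M_S\le k(|V(S)|+2)$. If $T$ is a tree of order $n\ge 2$ with $\ell$ leaves whose stem $S$ belongs to $\mathcal{S}_k$ and $$\ell\le\log_2\left(\frac{(1-k)n}{2\log_2(n)+2}\right)=\log_2(n)-\log_2(\log_2(n)+1)-\log_2\left(\tfrac{2}{1-k}\right),$$ then $T$ is not optimal in $\mathcal{T}_n$.
   Context: The order of a graph is its number of vertices; $V(S)$ is the vertex set of $S$. A subtree of a tree $T$ is a nonempty connected subgraph. The mean subtree order $M_T$ is the average of the orders of all subtrees of $T$. A tree of maximum mean subtree order in a given family is called optimal in that family. $\mathcal{T}_n$ is the family of all trees of order $n$. For a tree $T$ of order at least $2$, the stem of $T$ is the tree obtained from $T$ by deleting all leaf vertices. (The density of a tree $S$ is $M_S/|V(S)|$; in particular, the family of trees of density at most $k$ is one possible $\mathcal{S}_k$.) *)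

(* Defs.v *)
From HB Require Import structures.
From mathcomp Require Import all_boot all_order all_algebra.
From mathcomp Require Import reals exp.

Set Implicit Arguments.
Unset Strict Implicit.
Unset Printing Implicit Defensive.
Import Order.TTheory GRing.Theory Num.Theory.

Record sgraph := SGraph {
  svertex :> finType;
  sedge : rel svertex;
  sedge_sym : symmetric sedge;
  sedge_irr : irreflexive sedge }.

Definition graph_order (G : sgraph) : nat := #|G|.

Definition connected (G : sgraph) : Prop :=
  0 < #|G| /\ forall x y : G, connect (@sedge G) x y.

Definition acyclic (G : sgraph) : Prop :=
  forall c : seq G, 2 < size c -> ~~ ucycleb (@sedge G) c.

Definition is_tree (G : sgraph) : Prop := connected G /\ acyclic G.

Definition trees_of_order (n : nat) (G : sgraph) : Prop :=
  is_tree G /\ graph_order G = n.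

Definition edges (G : sgraph) : {set {set G}} :=
  [set [set p.1; p.2] | p : G * G & sedge p.1 p.2].

(* A subgraph is a pair (vertex set, edge set), not necessarily induced. *)
Definition is_subgraph (G : sgraph) (H : {set G} * {set {set G}}) : bool :=
  (H.2 \subset edges G) && [forall e in H.2, e \subset H.1].

Definition subgraph_connected (G : sgraph) (H : {set G} * {set {set G}}) :
    bool :=
  [forall x in H.1, forall y in H.1,
     connect (fun u v : G => [set u; v] \in H.2) x y].

Definition subtrees (G : sgraph) : {set {set G} * {set {set G}}} :=
  [set H | [&& is_subgraph H, H.1 != set0 & subgraph_connected H]].

Definition leaves (G : sgraph) : {set G} :=
  [set x | #|[set y | sedge x y]| == 1].

Section Induced.
Variables (G : sgraph) (A : {set G}).

Definition induced_edge : rel {x : G | x \in A} :=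
  fun x y => sedge (val x) (val y).

Lemma induced_edge_sym : symmetric induced_edge.
Proof. by move=> x y; apply: sedge_sym. Qed.

Lemma induced_edge_irr : irreflexive induced_edge.
Proof. by move=> x; apply: sedge_irr. Qed.

Definition induced : sgraph := SGraph induced_edge_sym induced_edge_irr.
End Induced.

Definition stem (G : sgraph) : sgraph := induced (~: leaves G).

Local Open Scope ring_scope.

Definition mean_subtree_order (R : realType) (G : sgraph) : R :=
  (\sum_(H in subtrees G) #|H.1|)%:R / #|subtrees G|%:R.

Definition optimal (R : realType) (F : sgraph -> Prop) (T : sgraph) : Prop :=
  F T /\ forall T' : sgraph, F T' ->
    mean_subtree_order R T' <= mean_subtree_order R T.

Definition log2 (R : realType) (x : R) : R := ln x / ln 2.

(* Main.v *)
Require Import Defs.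
From HB Require Import structures.
From mathcomp Require Import all_boot all_order all_algebra.
From mathcomp Require Import reals exp.
From mathcomp Require Import zify ring lra.
Set Implicit Arguments.
Unset Strict Implicit.
Unset Printing Implicit Defensive.
Import Order.TTheory GRing.Theory Num.Theory.
Local Open Scope ring_scope.

(** Let [L] be the binary logarithm of [n]. The tree [T] is beaten by a baton, a
    path with [a] leaves at each end: the mean subtree order of [T] is at most
    [n - c], and that of a suitable baton of order [n] is larger than [n - c],
    where [c = 2 * L + 5 / 2].

    A subtree of [T] is a single leaf or a subtree [A] of the stem together with
    an arbitrary set of the leaves attached to [A] ([sum_cset_leaves]). Hence
    each subtree of the stem is counted with a weight between [1] and [2 ^ l],
    where [l] is the number of leaves. Such a weighting can divide the average
    number of missing stem vertices by [2 ^ l] at most. The unweighted average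
    is about [(1 - k) * n] or more by hypothesis on the stem, and the bound on
    [l] says exactly that [(1 - k) * n / 2 ^ l] is at least [2 * L + 2]. On
    average half of the available leaves are missing too, and with at least two
    leaves ([two_leaves]) the error terms are covered, giving an average loss of
    at least [c] ([deficit_ge0_of_stem]).

    In a baton with [2 ^ a >= n ^ 2], the subtrees that contain the whole path
    outnumber all the others so much that these cost only a bounded amount,
    while the former miss [a] vertices on average. Taking [a] minimal, the loss
    is less than [a + 3 / 2 <= c] ([baton_deficit_lt0]).

    In both cases subtrees are first replaced by connected vertex sets, which is
    possible because subtrees of a tree are induced ([subtree_edges]). *)

(** * Subtrees of a tree as connected vertex sets *)

Lemma connect_homo (T U : finType) (e : rel T) (e' : rel U) (f : T -> U) :
  (forall u v, e u v -> connect e' (f u) (f v)) ->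
  forall x y, connect e x y -> connect e' (f x) (f y).
Proof.
move=> fe x y /connectP[p]; elim: p x => [|z p IHp] x /= => [_ -> //|].
by case/andP=> /fe xz /IHp zy /zy; apply: connect_trans.
Qed.

Lemma connect_step (T : finType) (e : rel T) x y :
  connect e x y -> x != y -> exists z, e x z.
Proof.
case/connectP=> [[|z p]] /=; first by move=> _ -> /eqP.
by case/andP=> xz _ _ _; exists z.
Qed.

Section ConnectedSets.
Variable G : sgraph.

Definition edge_in (A : {set G}) : rel G :=
  fun u v => [&& u \in A, v \in A & sedge u v].

(** Connected vertex sets stand for subtrees: they form sums over [{set G}],
    which can be split and reindexed. *)
Definition cset (A : {set G}) : bool :=
  (A != set0) && [forall x in A, forall y in A, connect (edge_in A) x y].

Definition edges_in (A : {set G}) : {set {set G}} :=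
  [set e in edges G | e \subset A].

Lemma edge_in_sym A : symmetric (edge_in A).
Proof. by move=> u v; rewrite /edge_in sedge_sym andbCA. Qed.

Lemma csetP A :
  reflect (A != set0 /\ {in A &, forall x y, connect (edge_in A) x y}) (cset A).
Proof.
apply: (iffP andP) => -[-> cA]; split=> //.
  by move=> x y xA yA; have /forall_inP/(_ x xA)/forall_inP/(_ y yA) := cA.
by apply/forall_inP=> x xA; apply/forall_inP=> y yA; apply: cA.
Qed.

Lemma cset1 x : cset [set x].
Proof.
apply/csetP; split; first by apply/set0Pn; exists x; rewrite set11.
by move=> y z /set1P-> /set1P->.
Qed.

Lemma connected_cset : connected G -> cset setT.
Proof.
case=> G0 cG; apply/csetP; split; first by rewrite -cards_eq0 cardsT -lt0n.
move=> x y _ _; apply: (connect_homo (f := id)) (cG x y) => u v uv.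
by apply: connect1; rewrite /edge_in !inE.
Qed.

Lemma mem_edges x y : ([set x; y] \in edges G) = sedge x y.
Proof.
apply/imsetP/idP=> [[[u v]]|xy]; last by exists (x, y); rewrite ?inE.
rewrite inE /= => uv E.
have nuv : u != v by apply/eqP=> uE; move: uv; rewrite uE sedge_irr.
have := set21 u v; rewrite -E => /set2P uxy.
have := set22 u v; rewrite -E => /set2P vxy.
case: uxy vxy nuv uv => -> [] -> //; first by rewrite eqxx.
  by rewrite sedge_sym.
by rewrite eqxx.
Qed.

Lemma mem_edges_in A x y : ([set x; y] \in edges_in A) = edge_in A x y.
Proof.
rewrite inE mem_edges subUset !sub1set /edge_in.
by rewrite andbC andbA.
Qed.

Hypothesis acG : acyclic G.

(** If an edge of [G] joins two vertices of a connected subgraph that does not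
    contain that edge, the path between them inside the subgraph closes up with
    it to a cycle; so a subtree of a tree is induced. *)
Lemma subtree_edges (H : {set G} * {set {set G}}) :
  H \in subtrees G -> H.2 = edges_in H.1.
Proof.
rewrite inE => /and3P[/andP[H2G /forall_inP H21] _ cH].
apply/setP=> e; apply/idP/idP=> [eH|].
  by rewrite inE (subsetP H2G _ eH) H21.
rewrite inE => /andP[/imsetP[[x y]]]; rewrite inE /= => xy ->.
rewrite subUset !sub1set => /andP[xH yH].
have /forall_inP/(_ x xH)/forall_inP/(_ y yH) := cH.
case/connectP=> p0 /shortenP[p pp up _] yl.
have pG : path (@sedge G) x p.
  by apply: sub_path pp => u v uv; rewrite -mem_edges (subsetP H2G).
case: p pp up yl pG => [|z [|w p]] pp up yl pG.
- by move: xy; rewrite yl sedge_irr.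
- by case/andP: pp => xzH _; rewrite (_ : y = z).
have /negP[] := acG (c := [:: x, z, w & p]) isT.
by rewrite /ucycleb up /cycle rcons_path -yl pG sedge_sym xy.
Qed.

Lemma mem_subtrees H : (H \in subtrees G) = cset H.1 && (H.2 == edges_in H.1).
Proof.
have conE A : (forall x y, connect (fun u v : G => [set u; v] \in edges_in A) x y
    = connect (edge_in A) x y).
  by move=> x y; apply: eq_connect => u v; rewrite mem_edges_in.
apply/idP/andP=> [HG|[/csetP[H0 cH] /eqP H2]].
  have H2 := subtree_edges HG; split; last exact/eqP.
  move: HG; rewrite inE => /and3P[_ H0 cH]; apply/csetP; split=> // x y xH yH.
  have /forall_inP/(_ x xH)/forall_inP/(_ y yH) := cH.
  by rewrite H2 conE.
rewrite inE; apply/and3P; split=> //.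
  rewrite /is_subgraph H2; apply/andP; split.
    by apply/subsetP=> e; rewrite inE => /andP[].
  by apply/forall_inP=> e; rewrite inE => /andP[].
apply/forall_inP=> x xH; apply/forall_inP=> y yH.
by rewrite H2 conE; apply: cH.
Qed.

Lemma sum_subtrees (V : nmodType) (F : {set G} -> V) :
  \sum_(H in subtrees G) F H.1 = \sum_(A | cset A) F A.
Proof.
rewrite (reindex_onto (fun A => (A, edges_in A)) fst) /=.
  by apply: eq_bigl => A; rewrite mem_subtrees /= !eqxx !andbT.
by move=> [A E]; rewrite mem_subtrees /= => /andP[_ /eqP->].
Qed.

End ConnectedSets.

Lemma subtrees_gt0 (G : sgraph) : is_tree G -> (0 < #|subtrees G|)%N.
Proof.
case=> -[/card_gt0P[x _] _] acG; apply/card_gt0P.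
exists ([set x], edges_in [set x]).
by rewrite mem_subtrees // cset1 eqxx.
Qed.

(** Comparing the mean subtree order with [v] amounts to finding the sign of a
    sum over connected sets. Both inequalities in the proof are obtained this
    way, with [v] equal to the order minus an allowed loss. *)
Lemma sum_deficit (R : realType) (G : sgraph) (v : R) : is_tree G ->
  \sum_(A : {set G} | cset A) (v - #|A|%:R)
    = #|subtrees G|%:R * (v - mean_subtree_order R G).
Proof.
move=> tG; rewrite -sum_subtrees ?sumrB ?sumr_const; last exact: tG.2.
rewrite mulrBr /mean_subtree_order natr_sum mulrCA divff.
  by rewrite mulr1 mulr_natl.
by rewrite pnatr_eq0 -lt0n subtrees_gt0.
Qed.

(** * Splitting off the leaves *)

Section Leaves.
Variable G : sgraph.

Lemma leafP (x : G) : reflect (exists y, forall z, sedge x z = (z == y))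
  (x \in leaves G).
Proof.
rewrite inE; apply: (iffP cards1P) => -[y xy]; exists y.
  by move=> z; rewrite -in_set1 -xy inE.
by apply/setP=> z; rewrite !inE xy.
Qed.

Definition leaves_at (A : {set G}) : {set G} :=
  [set x in leaves G | [exists y in A, sedge x y]].

Definition leafless (A : {set G}) : bool := [disjoint A & leaves G].

(** Maps each leaf to its neighbour and fixes every other vertex. It turns
    edges into edges or equalities, so it carries a path through leaves to a
    path that avoids them. *)
Definition shrink (x : G) : G :=
  if x \in leaves G then odflt x [pick y | sedge x y] else x.

Lemma shrinkN x : x \notin leaves G -> shrink x = x.
Proof. by rewrite /shrink => /negbTE->. Qed.

Lemma shrink_leaf x y : x \in leaves G -> sedge x y -> shrink x = y.
Proof.
rewrite /shrink => xl; rewrite xl; have /leafP[z xz] := xl.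
rewrite xz => /eqP->; case: pickP => [w|/(_ z)]; rewrite xz ?eqxx //.
by move/eqP.
Qed.

(** Excludes the tree with a single edge as a component: with it, every leaf
    hangs on the leafless part of the graph. *)
Hypothesis leaf_nbr :
  forall x y : G, x \in leaves G -> sedge x y -> y \notin leaves G.

Lemma cset_leaves (A : {set G}) :
  cset A && (A :\: leaves G == set0) = (A \in [set [set x] | x in leaves G]).
Proof.
apply/andP/imsetP=> [[/csetP[/set0Pn[x xA] cA] /eqP A0]|[x xl ->]]; last first.
  by rewrite cset1 setD_eq0 sub1set.
have Al y : y \in A -> y \in leaves G.
  by apply/subsetP: y; rewrite -setD_eq0 A0.
exists x; first exact: Al.
apply/setP=> y; rewrite !inE; apply/idP/eqP=> [yA|->//].
apply/eqP; apply: contraT => yx.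
have [|z] := connect_step (cA x y xA yA); first by rewrite eq_sym.
case/and3P=> _ zA xz; have := leaf_nbr (Al x xA) xz.
by rewrite Al.
Qed.

Lemma cset_core (A : {set G}) : cset A -> A :\: leaves G != set0 ->
  cset (A :\: leaves G) /\ A :&: leaves G \subset leaves_at (A :\: leaves G).
Proof.
move=> /csetP[A0 cA] R0; split.
  apply/csetP; split=> // x y /setDP[xA xl] /setDP[yA yl].
  rewrite -(shrinkN xl) -(shrinkN yl); apply: connect_homo (cA x y xA yA) => u v.
  case/and3P=> uA vA uv.
  have [ul|ul] := boolP (u \in leaves G).
    by rewrite (shrink_leaf ul uv) (shrinkN (leaf_nbr ul uv)).
  have [vl|vl] := boolP (v \in leaves G).
    by rewrite (shrinkN ul) (@shrink_leaf v u) // sedge_sym.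
  by rewrite !shrinkN //; apply: connect1; rewrite /edge_in !in_setD ul vl uA vA.
apply/subsetP=> x /setIP[xA xl]; rewrite inE xl /=.
have /set0Pn[y /setDP[yA yl]] := R0.
have [|z /and3P[_ zA xz]] := connect_step (cA x y xA yA).
  by apply: contraNneq yl => <-.
apply/exists_inP; exists z => //.
by rewrite in_setD zA (leaf_nbr xl xz).
Qed.

Lemma cset_extend (A X : {set G}) :
  cset A -> X \subset leaves_at A -> cset (A :|: X).
Proof.
move=> /csetP[A0 cA] /subsetP XA.
have sub u v : connect (edge_in A) u v -> connect (edge_in (A :|: X)) u v.
  apply: (connect_homo (f := id)) => {u v} u v /and3P[uA vA uv].
  by apply: connect1; rewrite /edge_in !inE uA vA.
have toA x : x \in A :|: X ->
    exists2 y, y \in A & connect (edge_in (A :|: X)) x y.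
  case/setUP=> [xA|xX]; first by exists x.
  have := XA x xX; rewrite inE => /andP[_ /exists_inP[y yA xy]].
  by exists y => //; apply: connect1; rewrite /edge_in !inE yA xX xy orbT.
apply/csetP; split.
  by have /set0Pn[x xA] := A0; apply/set0Pn; exists x; rewrite inE xA.
move=> x y /toA[x' x'A xx'] /toA[y' y'A yy'].
apply: connect_trans xx' _; apply: connect_trans (sub _ _ (cA _ _ x'A y'A)) _.
by rewrite (sym_connect_sym (@edge_in_sym _ _)).
Qed.

(** Complementation in [X] shows that the average size of a subset of [X] is
    half the size of [X]. *)
Lemma sum_powerset (R : realFieldType) (X : {set G}) (v : R) :
  \sum_(Y in powerset X) (v - #|Y|%:R) = 2 ^+ #|X| * (v - #|X|%:R / 2).
Proof.
have E : \sum_(Y in powerset X) (#|Y|%:R : R)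
    = \sum_(Y in powerset X) (#|X|%:R - #|Y|%:R).
  rewrite (reindex_onto (fun Y => X :\: Y) (fun Y => X :\: Y)) /=; last first.
    by move=> Y; rewrite powersetE => YX; rewrite setDDr setDv set0U (setIidPr YX).
  apply: eq_big => [Y|Y]; rewrite !powersetE subsetDl setDDr setDv set0U /=.
    exact/eqP/setIidPr.
  move/eqP/setIidPr=> YX.
  by rewrite cardsD (setIidPr YX) natrB // subset_leq_card.
move: E; rewrite !sumrB !sumr_const card_powerset -(mulr_natl v)
  -(mulr_natl #|X|%:R) natrX.
move: (\sum_(_ in _) _) => s E.
rewrite (_ : s = 2 ^+ #|X| * #|X|%:R / 2); first by field.
by move: (2 ^+ _ * _) E => t E; lra.
Qed.

(** A connected set is a single leaf, or consists of a leafless connected set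
    together with an arbitrary set of the leaves attached to it; the leaves in
    the second kind are summed out by [sum_powerset]. *)
Lemma sum_cset_leaves (R : realFieldType) (v : R) :
  \sum_(A : {set G} | cset A) (v - #|A|%:R) =
  \sum_(A : {set G} | cset A && leafless A)
     2 ^+ #|leaves_at A| * (v - #|A|%:R - #|leaves_at A|%:R / 2)
  + #|leaves G|%:R * (v - 1).
Proof.
rewrite (bigID (fun A : {set G} => A :\: leaves G == set0)) /= addrC; congr (_ + _).
  rewrite (partition_big (fun A : {set G} => A :\: leaves G)
      (fun A => cset A && leafless A)) /=; last first.
    move=> A /andP[cA A0]; have [-> _] := cset_core cA A0.
    by rewrite /leafless disjoint_sym disjoints_subset setCD subsetUr.
  apply: eq_bigr => A /andP[cA dA].
  have A0 : A != set0 by case/csetP: cA.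
  rewrite -sum_powerset.
  rewrite (reindex_onto (fun Y => A :|: Y) (fun Y => Y :&: leaves G)) /=.
    apply: eq_big => [Y|Y].
      rewrite powersetE; apply/idP/idP.
        case/andP=> /andP[/andP[cY Y0] /eqP YA] /eqP YE.
        have [_] := cset_core cY Y0.
        by rewrite YA YE.
      move=> YA; have Yl : Y \subset leaves G.
        by apply: subset_trans YA _; apply/subsetP=> x; rewrite inE => /andP[].
      have DA : (A :|: Y) :\: leaves G = A.
        rewrite setDUl (_ : Y :\: _ = set0) ?setU0.
          exact/setDidPl.
        by apply/eqP; rewrite setD_eq0.
      rewrite cset_extend // DA A0 eqxx /= setIUl.
      by rewrite (disjoint_setI0 dA) set0U (setIidPl Yl).
    move=> /andP[_ /eqP YE].
    rewrite cardsU (_ : A :&: Y = set0) ?cards0 ?subn0 ?natrD ?opprD ?addrA //.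
    apply/eqP; rewrite -subset0; apply/subsetP=> x.
    case/setIP=> xA xY; move: xY; rewrite -YE => /setIP[_ xl].
    by have := disjointFr dA xA; rewrite xl.
  move=> Y /andP[/andP[_ _] /eqP <-].
  by rewrite setUC setID.
rewrite (eq_bigl _ _ cset_leaves).
rewrite big_imset /=; last by move=> x y _ _; apply: set1_inj.
under eq_bigr do rewrite cards1.
by rewrite sumr_const mulr_natl.
Qed.

End Leaves.

(** * The stem *)

Lemma card_stem (G : sgraph) : #|stem G| = (#|G| - #|leaves G|)%N.
Proof.
by rewrite /stem /= card_sig -(cardsC (leaves G)) addKn; apply: eq_card => x.
Qed.

Lemma cset_stem (G : sgraph) (B : {set stem G}) : cset B = cset (val @: B).
Proof.
apply/csetP/csetP=> -[B0 cB]; split.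
- by apply: contraNneq B0 => /eqP; rewrite imset_eq0.
- move=> _ _ /imsetP[x xB ->] /imsetP[y yB ->].
  apply: connect_homo (cB x y xB yB) => u v /and3P[uB vB uv].
  by apply: connect1; rewrite /edge_in !imset_f.
- by rewrite -(imset_eq0 val).
move=> x y xB yB; have /connectP[p] := cB _ _ (imset_f val xB) (imset_f val yB).
elim: p x xB => [|z p IHp] x xB /= => [_ /val_inj-> //|].
case/andP=> /and3P[_ /imsetP[w wB ->] xw] pp yl.
by apply: connect_trans (IHp w wB pp yl); apply: connect1; rewrite /edge_in xB wB.
Qed.

Lemma sum_cset_stem (V : nmodType) (G : sgraph) (F : nat -> V) :
  \sum_(B : {set stem G} | cset B) F #|B| =
  \sum_(A : {set G} | cset A && leafless A) F #|A|.
Proof.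
rewrite [RHS](reindex_onto (fun B : {set stem G} => val @: B)
                           (fun A => val @^-1: A)) /=; last first.
  move=> A /andP[_ dA]; apply/setP=> x; apply/imsetP/idP=> [[y yA ->]|xA].
    by rewrite inE in yA.
  have xS : x \in ~: leaves G by rewrite in_setC (disjointFr dA xA).
  by exists (Sub x xS); rewrite ?inE.
apply: eq_big => [B|B _]; last by rewrite card_imset //; apply: val_inj.
rewrite cset_stem; case: (cset _) => //=; apply/esym/andP; split.
  rewrite /leafless disjoint_subset; apply/subsetP=> _ /imsetP[y _ ->].
  by have := valP y; rewrite in_setC.
apply/eqP/setP=> x; rewrite inE; apply/imsetP/idP=> [[y yB /val_inj->] //|xB].
by exists x.
Qed.

(** Two adjacent leaves form a connected component, which would be the whole
    graph and leave the stem empty. *)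
Lemma leaf_nbr_stem (G : sgraph) : connected G -> (0 < #|stem G|)%N ->
  forall x y : G, x \in leaves G -> sedge x y -> y \notin leaves G.
Proof.
move=> [_ cG] /card_gt0P[[z zS] _] x y /leafP[x' xE] xy.
apply/negP=> /leafP[y' yE].
have xE' w : sedge x w = (w == y) by move: xy; rewrite !xE => /eqP->.
have yE' w : sedge y w = (w == x) by move: xy; rewrite sedge_sym !yE => /eqP->.
have cl : closed (@sedge G) (pred2 x y).
  apply: intro_closed; first exact/sym_connect_sym/sedge_sym.
  move=> u v uv /pred2P[] uE; move: uv; rewrite uE ?xE' ?yE' => /eqP->.
    by rewrite !inE eqxx orbT.
  by rewrite !inE eqxx.
have := closed_connect cl (cG x z); rewrite !inE eqxx /= => /esym/orP zxy.
move: zS; rewrite in_setC => /negP[]; apply/leafP.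
by case: zxy => /eqP->; [exists y | exists x].
Qed.

(** * Leaves and recognition of trees *)

(** Both ends of a longest path are leaves: another neighbour of an end would
    either extend the path or close a cycle. *)
Lemma two_leaves (G : sgraph) :
  connected G -> acyclic G -> (1 < #|G|)%N -> (1 < #|leaves G|)%N.
Proof.
move=> [_ cG] acG /card_gt1P[x0 [y0 [_ _ xy0]]].
pose P k := [exists t : k.-tuple G, uniq t && sorted (@sedge G) t].
have P2 : P 2.
  have [z xz] := connect_step (cG x0 y0) xy0.
  apply/existsP; exists [tuple x0; z]; rewrite /= xz inE !andbT.
  by apply: contraTneq xz => ->; rewrite sedge_irr.
have Pm k : P k -> (k <= #|G|)%N.
  case/existsP=> t /andP[ut _]; rewrite -(size_tuple t) -(card_uniqP ut).
  exact: max_card.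
have exP : exists k, P k by exists 2.
case: (ex_maxnP exP Pm) => m /existsP[t /andP[ut st]] maxP.
have m2 := maxP 2 P2.
have head_leaf x y s : size (x :: y :: s) = m -> uniq [:: x, y & s] ->
    sorted (@sedge G) [:: x, y & s] -> x \in leaves G.
  move=> sz us ss; apply/leafP; exists y => z; apply/idP/eqP=> [xz|->]; last first.
    by case/andP: ss.
  apply/eqP; apply: contraT => zy.
  have [|zs] := boolP (z \in [:: x, y & s]); last first.
    have : (m.+1 <= m)%N.
      apply: maxP; have sz' : size [:: z, x, y & s] == m.+1 by rewrite /= -sz.
      apply/existsP; exists (Tuple sz').
      have -> : uniq (Tuple sz') = uniq [:: z, x, y & s] by [].
      have -> : sorted (@sedge G) (Tuple sz')
              = sorted (@sedge G) [:: z, x, y & s] by [].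
      by move: us ss zs => /= -> ->; rewrite sedge_sym xz => ->.
    by rewrite ltnn.
  rewrite !inE (negPf zy) (_ : z == x = false) /=; last first.
    by apply: contraTF xz => /eqP->; rewrite sedge_irr.
  move=> zs'; case/splitPr: zs' sz us ss => s1 s2 sz us ss.
  have sz3 : (2 < size [:: x, y & rcons s1 z])%N by rewrite /= size_rcons.
  have /negP[] := acG _ sz3.
  move: us ss; rewrite -cat_rcons /ucycleb /cycle -cat_cons -cat_cons.
  rewrite cat_uniq => /andP[-> _] /=.
  rewrite cat_path (rcons_path _ _ (rcons _ _)) last_rcons => /and3P[-> -> _].
  by rewrite sedge_sym xz.
case: t => t /= tm in ut st; have {tm}tm := eqP tm.
have rt : sorted (@sedge G) (rev t).
  by rewrite rev_sorted; apply: sub_sorted st => u v; rewrite sedge_sym.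
case: t tm ut st rt => [|x [|y s]] tm ut st rt; [by rewrite -tm in m2 ..|].
have xl := head_leaf x y s tm ut st.
apply/card_gt1P; exists x, (last y s); split=> //.
  have : rev [:: x, y & s] = last y s :: behead (rev [:: x, y & s]).
    by rewrite lastI rev_rcons.
  case E : (behead _) => [|z s'] rE.
    by have := size_rev [:: x, y & s]; rewrite rE.
  apply: (head_leaf _ z s'); rewrite -rE ?size_rev ?rev_uniq //.
by apply: contraTneq ut => ->; rewrite /= mem_last.
Qed.

(** A criterion for trees: descending in rank reaches the root, and a vertex of
    maximal rank on a cycle would have two neighbours of no larger rank. *)
Lemma ranked_tree (G : sgraph) (r : G -> nat) (root : G) :
  (forall x, x != root -> exists2 y, sedge x y & (r y < r x)%N) ->
  (forall x y z, sedge x y -> sedge x z ->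
     (r y <= r x)%N -> (r z <= r x)%N -> y = z) ->
  is_tree G.
Proof.
move=> down uni; split.
  have toroot x : connect (@sedge G) x root.
    have [n] := ubnP (r x); elim: n x => // n IHn x rx.
    have [->|xr] := eqVneq x root; first exact: connect0.
    have [y xy yx] := down x xr.
    by apply: connect_trans (connect1 xy) (IHn y _); apply: leq_trans yx rx.
  split=> [|x y]; first by apply/card_gt0P; exists root.
  apply: connect_trans (toroot x) _.
  rewrite (sym_connect_sym (@sedge_sym G)); exact: toroot.
move=> c c2; apply/negP=> /andP[cc uc].
have [x0 x0c] : exists x, x \in c.
  by case: c c2 {cc uc} => // x c _; exists x; rewrite inE eqxx.
case: (@arg_maxnP _ x0 (mem c) r x0c) => x xc xmax.
have [i s cE] := rot_to xc.
move: cc uc c2; rewrite -(rot_cycle i) -(rot_uniq i) -(size_rot i) cE.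
have smax y : y \in s -> (r y <= r x)%N.
  move=> ys; apply: xmax.
  by rewrite -[mem c y]/(y \in c) -(mem_rot i) cE inE ys orbT.
case: s {cE} smax => [|y [|z s]] // smax.
rewrite /cycle [path _ _ _]/= rcons_path.
move=> /and3P[xy _ /andP[_ zx]] /and3P[_ yz _] _.
rewrite sedge_sym in zx.
have E : y = last z s.
  apply: (uni x) => //; apply: smax; first by rewrite inE eqxx.
  by rewrite inE mem_last orbT.
by move: yz; rewrite E mem_last.
Qed.

(** * Batons: paths with many leaves at both ends *)

Section Baton.
Variables p a : nat.

(** The spine [inl 0, ..., inl p] is a path, and [a] leaves [inr (b, x)] hang
    on each of its ends, [b] telling which end. *)
Definition baton_vertex : finType := ('I_p.+1 + bool * 'I_a)%type.

Definition spine_end (b : bool) : 'I_p.+1 := if b then ord_max else ord0.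

Definition baton_edge : rel baton_vertex := fun u v =>
  match u, v with
  | inl i, inl j => (i.+1 == j)%N || (j.+1 == i)%N
  | inl i, inr c => i == spine_end c.1
  | inr c, inl i => i == spine_end c.1
  | inr _, inr _ => false
  end.

Lemma baton_edge_sym : symmetric baton_edge.
Proof. by move=> [i|c] [j|d] //=; rewrite orbC. Qed.

Lemma baton_edge_irr : irreflexive baton_edge.
Proof. by move=> [i|c] //=; rewrite orbb; apply/eqP; lia. Qed.

Definition baton : sgraph := SGraph baton_edge_sym baton_edge_irr.

Lemma card_baton : #|baton| = (p.+1 + 2 * a)%N.
Proof. by rewrite card_sum card_prod card_bool !card_ord. Qed.

Lemma baton_tree : is_tree baton.
Proof.
apply: (@ranked_tree baton
  (fun u => if u is inl i then nat_of_ord i else p.+1) (inl ord0)).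
  move=> [i|c] xr; last by exists (inl (spine_end c.1)) => /=; rewrite ?eqxx.
  have i0 : (0 < i)%N.
    rewrite lt0n; apply: contraNneq xr => i0.
    by apply/eqP; congr inl; apply: val_inj.
  have := ltn_ord i => ip.
  by exists (inl (inord i.-1)); rewrite /= inordK; lia.
move=> [i|c] [j|d] [k|e] //=.
- move=> ij ik ji ki; congr inl; apply: val_inj => /=; lia.
- by move=> _ _ _; have := ltn_ord i; lia.
- by move=> _ _; have := ltn_ord i; lia.
- by move=> _ _; have := ltn_ord i; lia.
- by move=> /eqP-> /eqP->.
Qed.

Definition segment (lo hi : nat) : {set baton} :=
  [set u : baton | if u is inl i then (lo <= i <= hi)%N else false].

Lemma card_segment lo hi : (hi <= p)%N -> #|segment lo hi| = (hi.+1 - lo)%N.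
Proof.
move=> hip; rewrite -sum1_card big_mkcond big_sumType /=.
rewrite [X in (_ + X)%N]big1 ?addn0; last first.
  by move=> c _; rewrite inE.
under eq_bigr do rewrite inE.
rewrite -big_mkcond /= -[RHS]muln1 -sum_nat_const_nat (big_nat_widen _ _ p.+1) //.
rewrite (big_nat_widenl _ 0) //= big_mkord.
by apply: eq_bigl => i; rewrite ltnS andbC.
Qed.

Hypothesis a_gt0 : (0 < a)%N.

Lemma mem_leaves_baton (u : baton) :
  u \in leaves baton = (if u is inr _ then true else false).
Proof.
case: u => [i|c]; last by apply/leafP; exists (inl (spine_end c.1)) => -[j|d].
apply/negP=> /leafP[w wE]; have ip := ltn_ord i.
pose y : baton :=
  if i == ord0 then inr (false, Ordinal a_gt0) else inl (inord i.-1).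
pose z : baton :=
  if i == ord_max then inr (true, Ordinal a_gt0) else inl (inord i.+1).
have iy : @sedge baton (inl i) y.
  rewrite /y; case: eqP => [->//|i0] /=.
  have {}i0 : (i != 0 :> nat) by apply/eqP=> j0; apply: i0; apply: val_inj.
  by rewrite inordK; lia.
have iz : @sedge baton (inl i) z.
  rewrite /z; case: eqP => [->|ip0] /=; first exact: eqxx.
  have {}ip0 : (i != p :> nat) by apply/eqP=> j0; apply: ip0; apply: val_inj.
  by rewrite inordK; lia.
have : y = z by move: iy iz; rewrite !wE => /eqP-> /eqP->.
rewrite /y /z; case: eqP => [_|i0]; case: eqP => [_|ip'] // [].
have {}i0 : (i != 0 :> nat) by apply/eqP=> j0; apply: i0; apply: val_inj.
have {}ip' : (i != p :> nat) by apply/eqP=> j0; apply: ip'; apply: val_inj.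
by move/(congr1 val); rewrite /= !inordK; lia.
Qed.

Lemma card_leaves_at_baton (A : {set baton}) :
  #|leaves_at A| =
  (((inl ord0 : baton) \in A) * a + ((inl ord_max : baton) \in A) * a)%N.
Proof.
rewrite -sum1_card big_mkcond big_sumType /= big1 ?add0n; last first.
  by move=> i _; rewrite in_set mem_leaves_baton.
transitivity (\sum_(b : bool) \sum_(x < a)
    (if (inr (b, x) : baton) \in leaves_at A then 1 else 0))%N.
  by rewrite pair_bigA; apply: eq_bigr => -[].
have E b : (\sum_(x < a) (if (inr (b, x) : baton) \in leaves_at A then 1 else 0) =
    ((inl (spine_end b) : baton) \in A) * a)%N.
  rewrite (eq_bigr (fun=> (inl (spine_end b) : baton) \in A : nat)) => [|x _].
    by rewrite sum_nat_const card_ord mulnC.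
  rewrite in_set mem_leaves_baton /=.
  rewrite (_ : [exists y in A, _] = (inl (spine_end b) \in A)).
    by case: (_ \in _).
  apply/exists_inP/idP=> [[[i|c] yA //= /eqP iE]|yA]; first by rewrite -iE.
  by exists (inl (spine_end b)) => //=.
by rewrite big_bool !E addnC.
Qed.

(** The spine is what remains of the whole (connected) baton after its leaves
    are removed. *)
Lemma cset_spine : cset (segment 0 p) && leafless (segment 0 p).
Proof.
have E : segment 0 p = setT :\: leaves baton.
  by apply/setP=> -[i|c]; rewrite in_setD mem_leaves_baton !inE //= -ltnS ltn_ord.
have [] := @cset_core baton _ setT (connected_cset baton_tree.1).
- move=> [i|c] [j|d]; by rewrite !mem_leaves_baton.
- rewrite -E; apply/set0Pn; exists (inl ord0); by rewrite inE.
rewrite -E => -> _.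
by rewrite /leafless E disjoint_sym disjoints_subset setCD subsetUr.
Qed.

(** A leafless connected set is an interval of the spine: if a vertex [j]
    between two members were missing, the part of the set below [j] would be
    closed under adjacency in the set. *)
Lemma cset_segment A : cset A -> leafless A ->
  exists lo hi : 'I_p.+1, (lo <= hi)%N /\ A = segment lo hi.
Proof.
move=> /csetP[/set0Pn[[i0|c] x0A] cA] dA; last first.
  by have := disjointFr dA x0A; rewrite mem_leaves_baton.
pose Q i := inl i \in A.
have Qi0 : Q i0 by [].
case: (@arg_minnP _ i0 Q val Qi0) => lo loA lomin.
case: (@arg_maxnP _ i0 Q val Qi0) => hi hiA himax.
exists lo, hi; split; first exact: lomin.
apply/setP=> -[j|c]; rewrite inE; last first.
  by apply/negP=> cinA; have := disjointFr dA cinA; rewrite mem_leaves_baton.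
apply/idP/andP=> [jA|[loj jhi]]; first by split; [apply: lomin | apply: himax].
apply: contraT => jA.
have cl : closed (edge_in A)
    [pred u : baton | if u is inl i then (i < j)%N else false].
  apply: intro_closed; first exact/sym_connect_sym/edge_in_sym.
  move=> [i|c] [k|d] //= /and3P[iA kA ik]; rewrite !inE //=.
    have kj : k != j :> nat by apply: contraNneq jA => /val_inj <-.
    by move=> ij; move: ik; rewrite /= /baton_edge; lia.
  by have := disjointFr dA kA; rewrite mem_leaves_baton.
have := closed_connect cl (cA _ _ loA hiA).
have lj : lo != j :> nat by apply: contraNneq jA => /val_inj <-.
rewrite !inE /= => E; have : (lo < j)%N by rewrite ltn_neqAle lj.
by rewrite E ltnNge jhi.
Qed.

End Baton.

(** An upper bound for a sum over a family of sets that needs a parametrization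
    only up to surjectivity: parameters may name a set twice, or name sets
    outside the family. *)
Lemma ler_sum_cover (R : numDomainType) (I J : finType) (h : I -> J)
    (P : pred J) (F : J -> R) (B : I -> R) :
  (forall i, 0 <= B i) ->
  (forall j, P j -> exists2 i, h i = j & F j <= B i) ->
  \sum_(j | P j) F j <= \sum_i B i.
Proof.
move=> B0 cover; rewrite [leRHS](bigID (fun i => P (h i))) /=.
rewrite -[leLHS]addr0 lerD ?sumr_ge0 //.
rewrite (partition_big h P) //=; apply: ler_sum => j Pj.
have [i hi FB] := cover j Pj.
by rewrite (bigD1 i) /= ?hi ?Pj ?eqxx // -[leLHS]addr0 lerD ?sumr_ge0.
Qed.

(** The baton of order [n] with [a] leaves at each end and [2 ^ a] at least
    [n ^ 2] has mean subtree order above [n - (a + 3 / 2)]. Write [Z = 2 ^ a].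
    The [Z ^ 2] connected sets containing the whole spine miss [a] leaves on
    average, and contribute at most [- 3 / 2 * Z ^ 2] to the sum. Connected
    sets containing exactly one end of the spine contribute at most
    [Z * p * n <= Z ^ 2], and those containing no end, together with the single
    leaves, at most [n ^ 3 + n ^ 2 <= Z ^ 2 / 4]. *)
Lemma baton_deficit_lt0 (R : realType) (p a n : nat) (c : R) :
  (0 < a)%N -> (p.+1 + 2 * a)%N = n -> (8 <= n)%N -> (n ^ 2 <= 2 ^ a)%N ->
  a%:R + 3 / 2 <= c ->
  \sum_(A : {set baton p a} | cset A) (n%:R - c - #|A|%:R) < 0.
Proof.
move=> a0 nE n8 nZ ca.
have leaf_nbr (x y : baton p a) : x \in leaves _ -> sedge x y -> y \notin leaves _.
  by move: x y => [i|e] [j|d]; rewrite !mem_leaves_baton.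
rewrite sum_cset_leaves // (bigD1 (segment p a 0 p)) /=; last exact: cset_spine.
set Z : R := 2 ^+ a.
have nEr : n%:R = p%:R + 1 + 2 * a%:R :> R by rewrite -nE natrD natrM -(natr1 p).
have cover :
   \sum_(A : {set baton p a} |
        (cset A && leafless A) && (A != segment p a 0 p))
     2 ^+ #|leaves_at A| * (n%:R - c - #|A|%:R - #|leaves_at A|%:R / 2)
   <= Z * (p%:R * n%:R) + (p%:R + 1) ^+ 2 * n%:R.
  (* Segments through the left end only, through the right end only, and all
     segments; the last family also repeats the first two. *)
  pose I : finType := ('I_p + ('I_p + 'I_p.+1 * 'I_p.+1))%type.
  pose h (x : I) := match x with
    | inl i => segment p a 0 i
    | inr (inl i) => segment p a i.+1 p
    | inr (inr q) => segment p a q.1 q.2 end.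
  pose B (x : I) : R := match x with
    | inl i => Z * (p%:R - i%:R + a%:R)
    | inr (inl i) => Z * (i%:R + 1 + a%:R)
    | inr (inr q) => n%:R end.
  have Z0 : 0 <= Z by apply: exprn_ge0.
  apply: le_trans (ler_sum_cover (h := h) (B := B) _ _) _.
  - move=> [i|[i|q]] //=; apply: mulr_ge0 => //; apply: addr_ge0 => //.
      by rewrite subr_ge0 ler_nat ltnW.
    exact: addr_ge0.
  - move=> A /andP[/andP[cA dA] AP].
    have [lo [hi [lohi AE]]] := cset_segment a0 cA dA.
    have lop := ltn_ord lo; have hip := ltn_ord hi.
    have aR : 0 <= a%:R :> R by [].
    have lA : #|leaves_at A| = ((lo == 0 :> nat) * a + (hi == p :> nat) * a)%N.
      rewrite card_leaves_at_baton // AE !inE /=.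
      by congr (nat_of_bool _ * a + nat_of_bool _ * a)%N; lia.
    have sA : #|A| = (hi.+1 - lo)%N by rewrite AE card_segment.
    have [lo0|lo0] := eqVneq (lo : nat) 0%N.
      have hp : (hi < p)%N.
        rewrite ltn_neqAle -ltnS hip andbT; apply: contraNneq AP => hpE.
        by rewrite AE lo0 hpE.
      exists (inl (Ordinal hp)) => /=; first by rewrite AE lo0.
      rewrite lA lo0 (ltn_eqF hp) mul1n mul0n addn0 sA lo0 subn0 -(natr1 hi) -/Z.
      apply: ler_wpM2l => //. lra.
    have [hiE|hiN] := eqVneq (hi : nat) p.
      have lp : (lo.-1 < p)%N by lia.
      exists (inr (inl (Ordinal lp))) => /=; first by rewrite AE hiE prednK // lt0n.
      rewrite lA (negPf lo0) hiE eqxx mul1n mul0n add0n sA hiE.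
      rewrite natrB ?ltnS 1?ltnW // -(natr1 p) -/Z.
      have loR : lo%:R = lo.-1%:R + 1 :> R by rewrite (natr1 lo.-1) prednK // lt0n.
      apply: ler_wpM2l => //; lra.
    exists (inr (inr (lo, hi))) => //=.
    rewrite lA (negPf lo0) (negPf hiN) !mul0n addn0 expr0 mul1r mul0r.
    have : 0 <= #|A|%:R :> R by [].
    by lra.
  (* Pairing the [i]-th segments at the two ends makes their bounds add up to
     the constant [Z * n]. *)
  rewrite !big_sumType /= addrA -big_split /=.
  rewrite (eq_bigr (fun=> Z * n%:R)); last first.
    by move=> i _; rewrite nEr; ring.
  rewrite !sumr_const card_prod !card_ord lerD //.
    by rewrite -(mulr_natl (Z * _)) mulrCA.
  by rewrite -(mulr_natl n%:R) natrM -(natr1 p) -expr2.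
have lP : #|leaves_at (segment p a 0 p)| = (2 * a)%N.
  by rewrite card_leaves_at_baton // !inE /= leqnn; lia.
rewrite lP card_segment // subn0.
have lB : #|leaves (baton p a)| = (2 * a)%N.
  rewrite -sum1_card big_mkcond big_sumType /= big1 ?add0n; last first.
    by move=> i _; rewrite mem_leaves_baton.
  rewrite (eq_bigr (fun=> 1%N)); last by move=> i _; rewrite mem_leaves_baton.
  by rewrite sum_nat_const muln1 card_prod card_bool card_ord.
rewrite lB mulnC exprM -/Z natrM -(natr1 p).
have nZr : n%:R ^+ 2 <= Z by rewrite /Z -!natrX ler_nat.
have n8r : 8 <= n%:R :> R by rewrite ler_nat.
have p0r : 0 <= p%:R :> R by [].
have a1r : 1 <= a%:R :> R by rewrite ler1n.
move: cover; set S := \sum_(_ | _) _ => cover.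
set N : R := n%:R in nEr nZr n8r cover *.
set P : R := p%:R in nEr p0r cover *.
set D : R := a%:R in nEr ca a1r *.
have Zge0 : 0 <= Z by apply: exprn_ge0.
have ZZ : N ^+ 2 * Z <= Z ^+ 2.
  by rewrite [leRHS]expr2 ler_wpM2r.
have main : Z ^+ 2 * (N - c - (P + 1) - D * 2 / 2) <= - (3 / 2) * Z ^+ 2.
  by rewrite [leLHS]mulrC ler_wpM2r ?sqr_ge0 //; lra.
have one : Z * (P * N) <= Z ^+ 2.
  apply: le_trans _ ZZ; rewrite [leLHS]mulrC ler_wpM2r //.
  by rewrite expr2; apply: ler_wpM2r; lra.
have n64 : 64 * N ^+ 2 <= N ^+ 2 * Z.
  rewrite [leLHS]mulrC ler_wpM2l ?sqr_ge0 //; apply: le_trans _ nZr.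
  by nra.
have n8N : 8 * (N ^+ 2 * N) <= N ^+ 2 * Z.
  rewrite mulrCA ler_wpM2l ?sqr_ge0 //; apply: le_trans _ nZr.
  by rewrite expr2; apply: ler_wpM2r; lra.
have two : (P + 1) ^+ 2 * N <= N ^+ 2 * N.
  by apply: ler_wpM2r; [lra | nra].
have three : D * 2 * (N - c - 1) <= N ^+ 2.
  by nra.
have Zpos : 0 < Z ^+ 2 by rewrite !exprn_gt0.
lra.
Qed.

(** * Binary logarithms *)

Lemma le_expn2_log2 (R : realType) (m : nat) (x : R) :
  0 < x -> m%:R <= log2 x -> 2 ^+ m <= x.
Proof.
move=> x0; rewrite /log2 ler_pdivlMr ?ln_gt0 ?ltr1n // => H.
rewrite -ler_ln ?posrE ?exprn_gt0 //.
by rewrite lnXn // -[leLHS]mulr_natl.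
Qed.

Lemma log2_stem_identity (R : realType) (k x : R) : 1 < x -> k < 1 ->
  log2 ((1 - k) * x / (2 * log2 x + 2))
    = log2 x - log2 (log2 x + 1) - log2 (2 / (1 - k)).
Proof.
move=> x1 k1; have ln20 : 0 < ln 2 :> R by rewrite ln_gt0 ?ltr1n.
have L0 : 0 < log2 x by rewrite divr_gt0 // ln_gt0.
have -> : 2 * log2 x + 2 = 2 * (log2 x + 1) by ring.
have kpos : 0 < 1 - k by lra.
have L1 : 0 < log2 x + 1 by lra.
rewrite {1 3 4}/log2 -!mulrBl; congr (_ / _).
rewrite !ln_div ?posrE ?mulr_gt0 ?divr_gt0 //; try lra.
rewrite !lnM ?posrE //; try lra.
Qed.

(** * Comparison *)

(** Trees with few leaves lose much. With [s] the order of the stem, [l] the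
    number of leaves and [Q = 2 ^ l], summing out the leaves gives every
    subtree [A] of the stem a weight between [1] and [Q], and a loss of at least
    [s - #|A|] on the stem and [l / 2] on the leaves. Replacing all weights by
    the extreme ones leaves the unweighted mean over the stem, whose loss
    [s - M] is at least [(1 - k) * s - 2 * k]; divided by [Q] this is
    [2 * L + 2] up to an error that [l / 2] absorbs since there are two
    leaves. *)
Lemma deficit_ge0_of_stem (R : realType) (T : sgraph) (k L : R) :
  is_tree T -> is_tree (stem T) -> 0 <= k < 1 ->
  mean_subtree_order R (stem T) <= k * ((graph_order (stem T))%:R + 2) ->
  (1 < #|leaves T|)%N ->
  2 ^+ #|leaves T| * (2 * L + 2) <= (1 - k) * #|T|%:R ->
  2 * L + 7 / 2 <= #|T|%:R ->
  0 <= \sum_(A : {set T} | cset A) (#|T|%:R - (2 * L + 5 / 2) - #|A|%:R).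
Proof.
move=> [cT acT] sT /andP[k0 k1] Mk l2 QL nL.
rewrite (sum_cset_leaves (leaf_nbr_stem cT sT.1.1)).
have lT : (#|leaves T| <= #|T|)%N by apply: max_card.
have sE : #|stem T|%:R = #|T|%:R - #|leaves T|%:R :> R by rewrite card_stem natrB.
set l : R := #|leaves T|%:R; set Q : R := 2 ^+ #|leaves T|.
have lr2 : 2 <= l by rewrite ler_nat.
have Q4 : 4 <= Q.
  rewrite (_ : 4 = 2 ^+ 2) ?expr2; last by ring.
  by rewrite /Q -expr2 ler_eXn2l // ltr1n.
apply: addr_ge0; last by rewrite mulr_ge0 //; lra.
(* What the stem still has to lose after the leaves have lost [l / 2]. *)
pose e : R := 2 * L + 5 / 2 - l / 2.
pose s : R := #|stem T|%:R.
have loc (A : {set T}) : cset A && leafless A ->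
    2 ^+ #|leaves_at A| * (s - #|A|%:R - e) <=
    2 ^+ #|leaves_at A| * (#|T|%:R - (2 * L + 5 / 2) - #|A|%:R
                           - #|leaves_at A|%:R / 2) :> R.
  move=> _; apply: ler_wpM2l; first exact: exprn_ge0.
  have : #|leaves_at A|%:R <= l.
    rewrite ler_nat subset_leq_card //.
    by apply/subsetP=> x; rewrite inE => /andP[].
  by rewrite /s sE -/l /e; lra.
apply: le_trans (ler_sum _ loc) => {loc}.
have sA (A : {set T}) : leafless A -> #|A|%:R <= s.
  rewrite /leafless disjoints_subset => /subset_leq_card.
  rewrite (cardsCs (~: _)) setCK -card_stem.
  by rewrite ler_nat.
have [e0|e0] := leP e 0.
  apply: sumr_ge0 => A /andP[_ /sA As]; apply: mulr_ge0; first exact: exprn_ge0.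
  by lra.
apply: le_trans (_ : 0 <= \sum_(A : {set T} | cset A && leafless A)
                            (s - Q * e - #|A|%:R)) _.
  rewrite -(sum_cset_stem T (fun m => s - Q * e - m%:R)) sum_deficit // mulr_ge0 //.
  rewrite /graph_order sE -/l in Mk.
  have : Q * e = Q * (2 * L + 2) - Q * (l - 1) / 2 by rewrite /e; field.
  have : 2 * (l - 1) <= Q * (l - 1) / 2 by nra.
  have : k * 2 <= k * l by apply: ler_wpM2l.
  by move: Mk QL; rewrite /s sE -/l -/Q; lra.
apply: ler_sum => A /andP[_ /sA As].
have q1 : 1 <= 2 ^+ #|leaves_at A| :> R by rewrite exprn_ege1 // ler1n.
have qQ : 2 ^+ #|leaves_at A| <= Q.
  rewrite ler_eXn2l ?ltr1n // subset_leq_card //.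
  by apply/subsetP=> x; rewrite inE => /andP[].
by nra.
Qed.

Theorem corollary6p5 (R : realType) (k : R) (Sk : sgraph -> Prop)
    (k_ge : 1 / 3 <= k) (k_lt : k < 1)
    (Sk_tree : forall S : sgraph, Sk S -> is_tree S)
    (Sk_mean : forall S : sgraph, Sk S ->
       mean_subtree_order R S <= k * ((graph_order S)%:R + 2))
    (T : sgraph) (n : nat) (T_tree : is_tree T)
    (T_order : graph_order T = n) (n_ge2 : (2 <= n)%N)
    (T_stem : Sk (stem T)) :
  log2 ((1 - k) * n%:R / (2 * log2 n%:R + 2))
    = log2 n%:R - log2 (log2 n%:R + 1) - log2 (2 / (1 - k)) :> R
  /\ (#|leaves T|%:R <= log2 ((1 - k) * n%:R / (2 * log2 n%:R + 2)) ->
      ~ optimal R (trees_of_order n) T).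
Proof.
have n1 : 1 < n%:R :> R by rewrite ltr1n.
split; first exact: log2_stem_identity.
have ln20 : 0 < ln 2 :> R by rewrite ln_gt0 ?ltr1n.
set L : R := log2 n%:R.
have L0 : 0 < L by rewrite divr_gt0 // ln_gt0.
move=> /le_expn2_log2 QX [_ opt].
have l2 : (1 < #|leaves T|)%N.
  by apply: two_leaves T_tree.1 T_tree.2 _; rewrite -/(graph_order T) T_order.
have {}QX : 2 ^+ #|leaves T| * (2 * L + 2) <= (1 - k) * n%:R.
  by rewrite -ler_pdivlMr ?QX ?divr_gt0 ?mulr_gt0 //; lra.
have Q4 : 4 <= 2 ^+ #|leaves T| :> R.
  rewrite (_ : 4 = 2 ^+ 2) ?ler_eXn2l ?ltr1n //; by rewrite expr2; ring.
have nL : 8 * L + 8 <= n%:R by nra.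
pose c : R := 2 * L + 5 / 2.
have defT := deficit_ge0_of_stem T_tree (Sk_tree _ T_stem) _ (Sk_mean _ T_stem) l2.
have {}defT : mean_subtree_order R T <= n%:R - c.
  have := defT L; rewrite -/(graph_order T) T_order sum_deficit // => /(_ _ QX _).
  rewrite pmulr_rge0 ?ltr0n ?subtrees_gt0 // subr_ge0; apply; lra.
have n8 : (8 <= n)%N by rewrite -(ler_nat R); lra.
(* The rounding [a <= 2 * L + 1] leaves exactly the margin [a + 3 / 2 <= c]. *)
pose a := up_log 2 (n ^ 2).
have n2 : (1 < n ^ 2)%N by rewrite (ltn_exp2r 1 n (e := 2)).
have /andP[aL aU] := up_log_bounds (isT : (1 < 2)%N) n2.
have a0 : (0 < a)%N by rewrite up_log_gt0.
have aR : a%:R <= 2 * L + 1.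
  have : a.-1%:R * ln 2 <= 2 * ln n%:R :> R.
    rewrite !mulr_natl -!lnXn ?ltr0n 1?ltnW //.
    by rewrite ler_ln ?posrE ?exprn_gt0 ?ltr0n 1?ltnW // -!natrX ler_nat ltnW.
  rewrite -ler_pdivlMr // -mulrA -/(log2 _) -/L => H.
  by rewrite -(prednK a0) -natr1; lra.
have pE : ((n - (2 * a).+1).+1 + 2 * a)%N = n.
  have : ((2 * a).+1 <= n)%N by rewrite -(ler_nat R) -natr1 natrM; lra.
  by lia.
have B_tree := baton_tree (n - (2 * a).+1) a.
have B_order : graph_order (baton (n - (2 * a).+1) a) = n.
  by rewrite /graph_order card_baton.
have cR : a%:R + 3 / 2 <= c by rewrite /c; lra.
have := baton_deficit_lt0 a0 pE n8 aU cR.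
rewrite sum_deficit // pmulr_rlt0 ?ltr0n ?subtrees_gt0 // subr_lt0.
move/lt_le_trans/(_ (opt _ (conj B_tree B_order))).
by rewrite ltNge defT.
Qed.
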